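(* Let $L=\mathbb{Q}(\sqrt{3})$ with ring of integers $O_L$, and let $$f_6(q):=\sum_{n=1}^{\infty}(-1)^n\frac{(q)_{n-1}(q^2;q^2)_{n-1}}{(q)_{2n-1}}\,q^n.$$ Then $$q^{-1}f_6(q^4)=-\sum_{\substack{\mathbf{a}\subset O_L\\ \mathcal{N}(\mathbf{a})\equiv 3\pmod 4}}q^{\mathcal{N}(\mathbf{a})},$$ where the sum runs over the nonzero ideals $\mathbf{a}$ of $O_L$ with $\mathcal{N}(\mathbf{a})\equiv 3\pmod 4$.
   Context: Identities are between formal power series in $q$ (equivalently, for $0<|q|<1$). Notation: $(a;q)_n:=\prod_{j=0}^{n-1}(1-aq^j)$ and $(a)_n:=(a;q)_n$; thus $(q)_n=\prod_{j=1}^n(1-q^j)$ and $(q^2;q^2)_n=\prod_{j=1}^{n}(1-q^{2j})$. For an ideal $\mathbf{a}$ of $O_L$, $\mathcal{N}(\mathbf{a})=|O_L/\mathbf{a}|$ is its norm. *)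

(* Defs.v *)
From HB Require Import structures.
From mathcomp Require Import all_boot all_order all_algebra all_field.
From mathcomp Require Import finmap boolp classical_sets functions cardinality.
From mathcomp Require Import fsbigop.

Set Implicit Arguments.
Unset Strict Implicit.
Unset Printing Implicit Defensive.
Import Order.TTheory GRing.Theory Num.Theory.
Local Open Scope classical_set_scope.
Local Open Scope ring_scope.

(** * Formal power series and formal Laurent series over the integers *)

(** [f k] is the coefficient of q^k. *)
Definition fps := nat -> int.

Definition fps_one : fps := fun k => (k == 0%N)%:R.
Definition fps_opp (f : fps) : fps := fun k => - f k.
Definition fps_mul (f g : fps) : fps :=
  fun k => \sum_(i < k.+1) f i * g (k - i)%N.
Definition fps_monomial (n : nat) : fps := fun k => (k == n)%:R.
Definition fps_of_poly (p : {poly int}) : fps := fun k => p`_k.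

(** The first [n] coefficients of 1/f, from b_m = f_0^-1 ([m = 0] -
    \sum_(i < m) b_i f_(m-i)); meaningful when [f 0] is a unit. *)
Fixpoint fps_inv_coefs (f : fps) (n : nat) : seq int :=
  if n is m.+1 then
    let b := fps_inv_coefs f m in
    rcons b ((f 0%N)^-1 *
             (fps_one m - \sum_(i < m) b`_i * f (m - i)%N))
  else [::].
Definition fps_inv (f : fps) : fps := fun k => (fps_inv_coefs f k.+1)`_k.

Lemma size_fps_inv_coefs f n : size (fps_inv_coefs f n) = n.
Proof. by elim: n => //= n IHn; rewrite size_rcons IHn. Qed.

Lemma nth_fps_inv_coefs f n i : (i < n)%N -> (fps_inv_coefs f n)`_i = fps_inv f i.
Proof.
elim: n => // n IHn; rewrite ltnS leq_eqVlt => /predU1P[-> // | lt_in].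
by rewrite /= nth_rcons size_fps_inv_coefs lt_in IHn.
Qed.

Lemma fps_mul_inv (f : fps) :
  f 0%N \is a GRing.unit -> fps_mul (fps_inv f) f = fps_one.
Proof.
move=> f0U; apply/funext => k; rewrite /fps_mul big_ord_recr /= subnn.
rewrite {2}/fps_inv /= nth_rcons size_fps_inv_coefs ltnn eqxx.
rewrite [_ * f 0%N]mulrC mulrA divrr // mul1r.
under [X in _ - X]eq_bigr do rewrite nth_fps_inv_coefs //.
by rewrite addrC subrK.
Qed.

(** The series f(q^m), for m > 0. *)
Definition fps_subst_Xn (m : nat) (f : fps) : fps :=
  fun k => if (m %| k)%N then f (k %/ m)%N else 0.

(** Convergence of a family of series in Z[[q]]: each power of q occurs in only
    finitely many members.  [fps_sum] is meaningful for summable families. *)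
Definition fps_summable (I : choiceType) (A : set I) (F : I -> fps) : Prop :=
  forall k, finite_set [set i | A i /\ F i k <> 0].
Definition fps_sum (I : choiceType) (A : set I) (F : I -> fps) : fps :=
  fun k => \sum_(i \in A) F i k.

(** [f k] is the coefficient of q^k, now for k in Z. *)
Definition laurent := int -> int.

Definition laurent_of_fps (f : fps) : laurent :=
  fun k => if k is Posz n then f n else 0.

(** The series q^m f. *)
Definition laurent_shift (m : int) (f : laurent) : laurent := fun k => f (k - m).

(** * The series f_6 *)

(** (a; q)_n *)
Definition qpoch (a q : {poly int}) (n : nat) : {poly int} :=
  \prod_(j < n) (1 - a * q ^+ j).

(** The indeterminate q is ['X].  The denominator has constant coefficient 1. *)
Definition f6_term (n : nat) : fps :=
  fps_mul
    (fps_of_poly ((-1) ^+ n * (qpoch 'X 'X n.-1 * qpoch 'X^2 'X^2 n.-1) * 'X^n))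
    (fps_inv (fps_of_poly (qpoch 'X 'X (2 * n).-1))).

Definition f6 : fps := fps_sum [set n | (1 <= n)%N] f6_term.

(** * Ideals of the ring of integers of a number field *)

Definition ring_of_integers (L : fieldExtType rat) : set L :=
  [set x | integralOver (intr : int -> L) x].
Arguments ring_of_integers : clear implicits.

Record is_ideal (L : fieldExtType rat) (a : set L) : Prop := IsIdeal {
  ideal_sub : a `<=` ring_of_integers L;
  ideal0 : a 0;
  idealD : forall x y, a x -> a y -> a (x + y);
  idealM : forall r x, ring_of_integers L r -> a x -> a (r * x)
}.

(** O_L / a, as the set of the cosets x + a with x in O_L. *)
Definition ideal_quotient (L : fieldExtType rat) (a : set L) : set (set L) :=
  [set [set x + y | y in a] | x in ring_of_integers L].

(** |O_L / a|; [fset_set] makes this 0 when the quotient is infinite, which for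
    an ideal happens only if a = 0. *)
Definition ideal_norm (L : fieldExtType rat) (a : set L) : nat :=
  #|` fset_set (ideal_quotient a)|%fset.

Definition nonzero_ideals_norm_3mod4 (L : fieldExtType rat) : set (set L) :=
  [set a | [/\ is_ideal a, a <> [set 0] & ideal_norm a = 3 %[mod 4]]].
Arguments nonzero_ideals_norm_3mod4 : clear implicits.

(** L = Q(s) with s^2 = 3. *)
Definition is_Q_sqrt3 (L : fieldExtType rat) (s : L) : Prop :=
  s ^+ 2 = 3%:R /\ <<1; s>>%VS = fullv.

Lemma Q_sqrt3_exists : exists (L : fieldExtType rat) (s : L), is_Q_sqrt3 s.
Proof.
have [L [f [[|s [|? ?]] //= [fs] gens]]] := num_field_exists [:: sqrtC 3%:R].
exists L, s; split; last by rewrite -adjoin_seq1.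
by apply: (fmorph_inj f); rewrite rmorphXn /= fs sqrtCK rmorph_nat.
Qed.

(* Main.v *)
Require Import Defs.
From HB Require Import structures.
From mathcomp Require Import all_boot all_order all_algebra all_field.
From mathcomp Require Import finmap boolp classical_sets functions cardinality.
From mathcomp Require Import fsbigop.
From mathcomp Require Import ring lra zify.

Set Implicit Arguments.
Unset Strict Implicit.
Unset Printing Implicit Defensive.
Import Order.TTheory GRing.Theory Num.Theory.
Local Open Scope classical_set_scope.
Local Open Scope ring_scope.

(** Write (a)_n for (a; q)_n and P_r for the sum of q^(j(r-j)) over 0 <= j <= r.

The q-series side rests on two identities, [bailey_pair] and
[conjugate_bailey_pair], where sums are over all r <= n and all m >= k, and k >= 1:

  (q)_n / (q)_(2n+1)
    = sum_r (-1)^r q^(r(r+1)/2) (1 - q^(2r+2)) P_r / ((q)_(n-r) (q)_(n+r+2)),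

  sum_m (-q)^m (1 - q^(2k)) (q^2; q^2)_(m-1) / ((q)_(m-k) (q)_(m+k)) = (-q)^k.

Expanding (q)_(n-1) / (q)_(2n-1) in f_6 by the first and then summing over n by
the second leaves

  f_6 = - sum_r q^((r+1)(r+2)/2) P_r
      = - sum over 0 <= j <= r of q^((r+1)(r+2)/2 + j(r-j)),

which is [truncated_hecke_identity].  Each of the two identities has a
telescoping certificate, so that it reduces to a polynomial identity in q^n and
q^r; the first one uses in addition the recurrence P_(r+2) = 2 + q^(r+1) P_r.
Infinite sums are avoided by working in Z[X]/(X^(M+1)), where X is nilpotent and
the (q)_n are units; the coefficient of q^M is read off there.

The arithmetic side rests on the substitution x = r - 2j, y = r + 1, for which

  4 ((r+1)(r+2)/2 + j(r-j)) - 1 = 3 y^2 - x^2.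

Hence the coefficient of q^m in - f_6 is the number of integer points of the
cone |x| < y with x^2 - 3 y^2 = 1 - 4m; that x + y is odd is forced modulo 4.
The ring O_L is Z[s] ([ring_of_integersE]) and it is Euclidean for the norm, so
that every nonzero ideal is generated by some x + y s ([ideal_is_principal]) and
then has norm |x^2 - 3 y^2| ([ideal_norm_princ_ideal]).  As x^2 - 3 y^2 is never
3 modulo 4, an ideal of norm 4m - 1 has generators of norm 1 - 4m only.  The
units -1 and 2 + s, both of norm 1, move any of them into the cone
([princ_ideal_reduce]), and no unit other than 1 maps a point of the cone into
the cone ([unit_domain_unique]).  So the points counted by - f_6 are in
bijection with the ideals of norm 4m - 1 ([hecke_pairs_ideals_bij]). *)

(** * A Bailey pair and its conjugate *)

Definition poch (R : comNzRingType) (a q : R) (n : nat) : R :=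
  \prod_(j < n) (1 - a * q ^+ j).

Lemma pochS (R : comNzRingType) (a q : R) n :
  poch a q n.+1 = poch a q n * (1 - a * q ^+ n).
Proof. by rewrite /poch big_ord_recr. Qed.

Definition hecke_inner (R : comNzRingType) (q : R) (r : nat) : R :=
  \sum_(j < r.+1) q ^+ (j * (r - j)).

Lemma hecke_inner0 (R : comNzRingType) (q : R) : hecke_inner q 0 = 1.
Proof. by rewrite /hecke_inner big_ord1. Qed.

Lemma hecke_inner1 (R : comNzRingType) (q : R) : hecke_inner q 1 = 2.
Proof. by rewrite /hecke_inner big_ord_recl big_ord1. Qed.

Lemma hecke_innerSS (R : comNzRingType) (q : R) r :
  hecke_inner q r.+2 = 2 + q ^+ r.+1 * hecke_inner q r.
Proof.
rewrite /hecke_inner big_ord_recr big_ord_recl /= subnn muln0 mul0n expr0 addrAC.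
congr (_ + _); rewrite mulr_sumr; apply: eq_bigr => i _.
rewrite -exprD; congr (q ^+ _); rewrite /bump /=.
have := ltn_ord i; nia.
Qed.

(** Summation by parts against the recurrence of [hecke_inner]: once c vanishes
    from N + 2 on, only the terms where the recurrence has its constant 2, and
    the initial value 1 at r = 0, contribute. *)
Lemma hecke_inner_abel (R : comNzRingType) (q : R) (c : nat -> R) N :
  \sum_(r < N.+2) (c r - q ^+ r.+1 * c r.+2) * hecke_inner q r =
  c 0%N + 2 * \sum_(r < N.+1) c r.+1
    - q ^+ N.+1 * c N.+2 * hecke_inner q N - q ^+ N.+2 * c N.+3 * hecke_inner q N.+1.
Proof.
elim: N => [|N IHN].
  by rewrite !big_ord_recr !big_ord0 /= !add0r hecke_inner0 hecke_inner1 !exprS !expr0; ring.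
rewrite big_ord_recr IHN [in RHS]big_ord_recr /= hecke_innerSS.
rewrite !exprS; ring.
Qed.

Section InversePochhammer.
Variables (R : comNzRingType) (q : R) (u : nat -> R).
Hypothesis uK : forall n, u n * poch q q n = 1.

Lemma ipoch0 : u 0 = 1.
Proof. by have := uK 0; rewrite /poch big_ord0 mulr1. Qed.

(** With [u] in the role of 1/(q; q)_n, this relation replaces every division
    in what follows. *)
Lemma ipochS n : u n = (1 - q ^+ n.+1) * u n.+1.
Proof.
have := uK n; have := uK n.+1; rewrite pochS -exprS => u1 u2.
by rewrite -[LHS]mulr1 -[in LHS]u1 mulrCA (mulrA (u n)) u2 mul1r mulrC.
Qed.

Lemma one_sub_qX_cancel n (x y : R) :
  (1 - q ^+ n.+1) * x = (1 - q ^+ n.+1) * y -> x = y.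
Proof.
have := uK n.+1; rewrite pochS -exprS => u1 exy.
by rewrite -[x]mul1r -[y]mul1r -u1 -!mulrA exy.
Qed.

(** 1/(q; q)_(m-k) with the convention that it is 0 for k > m, so that sums over
    k need no upper bound and certificates hold at the boundary. *)
Definition ipoch_sub m k : R := if (k <= m)%N then u (m - k) else 0.

Lemma ipoch_sub0 m : ipoch_sub m 0 = u m.
Proof. by rewrite /ipoch_sub subn0. Qed.

Lemma ipoch_subSS m k : ipoch_sub m.+1 k.+1 = ipoch_sub m k.
Proof. by rewrite /ipoch_sub ltnS subSS. Qed.

Lemma ipoch_sub_gt m k : (m < k)%N -> ipoch_sub m k = 0.
Proof. by rewrite /ipoch_sub ltnNge => /negbTE->. Qed.

Lemma ipoch_sub_add m d : ipoch_sub (m + d) m = u d.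
Proof. by rewrite /ipoch_sub leq_addr addKn. Qed.

Lemma ipoch_sub_recr m d : ipoch_sub (m + d) m.+1 = (1 - q ^+ d) * u d.
Proof.
case: d => [|d]; first by rewrite addn0 ipoch_sub_gt // expr0 subrr mul0r.
by rewrite addnS ipoch_subSS ipoch_sub_add -ipochS.
Qed.

(** The coefficient of P_r in the Bailey pair relative to q^2. *)
Definition bailey_term n r : R :=
  (-1) ^+ r * q ^+ 'C(r.+1, 2) * (1 - q ^+ (2 * r + 2)) * ipoch_sub n r * u (n + r + 2).

(** Chosen so that c r - q^(r+1) c (r+2) is the defect of [bailey_term] in the
    recurrence in n of (q)_n / (q)_(2n+1); the operator applied to c is the
    adjoint of the recurrence of [hecke_inner]. *)
Definition bailey_cert n r : R :=
  q ^+ n * ((-1) ^+ r * q ^+ 'C(r, 2) * (1 + q ^+ r) * ipoch_sub n r * u (n + r)).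

Lemma bin2S r : 'C(r.+1, 2) = (r + 'C(r, 2))%N.
Proof. by rewrite binS bin1 addnC. Qed.

Lemma bailey_term_cert n r :
  (1 + q ^+ n.+1) * (1 - q ^+ (2 * n + 3)) * bailey_term n.+1 r - bailey_term n r =
  bailey_cert n.+1 r - q ^+ r.+1 * bailey_cert n.+1 r.+2.
Proof.
case: (leqP r n.+1) => [le_rn|gt_rn]; last first.
  by rewrite /bailey_term /bailey_cert ipoch_subSS !ipoch_sub_gt //; [ring | lia | lia].
have [e en] : exists e, n.+1 = (r + e)%N by exists (n.+1 - r)%N; lia.
rewrite /bailey_term /bailey_cert !bin2S.
have -> : ipoch_sub n r = (1 - q ^+ e) * u e by rewrite -ipoch_subSS en ipoch_sub_recr.
have -> : ipoch_sub n.+1 r = u e by rewrite en ipoch_sub_add.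
have -> : u (n + r + 2) = (1 - q ^+ (n + r + 3)) * u (n.+1 + r + 2).
  by rewrite ipochS; congr ((1 - q ^+ _) * u _); lia.
have -> : u (n.+1 + r) =
    (1 - q ^+ (n + r + 2)) * (1 - q ^+ (n + r + 3)) * u (n.+1 + r + 2).
  by rewrite ipochS ipochS -mulrA; congr ((1 - q ^+ _) * ((1 - q ^+ _) * u _)); lia.
have -> : (n.+1 + r.+2 = n.+1 + r + 2)%N by lia.
(* At r = n + 1 the shifted certificate is zero by convention. *)
case: e en => [|e] en.
  rewrite en ipoch_sub_gt; last by lia.
  rewrite (_ : 2 * n + 3 = 2 * r + 1)%N; last by lia.
  rewrite (_ : n + r + 2 = 2 * r + 1)%N; last by lia.
  rewrite (_ : n + r + 3 = 2 * r + 2)%N; last by lia.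
  rewrite !mul2n -!addnn !exprD !expr0; ring.
have -> : ipoch_sub n.+1 r.+2 = (1 - q ^+ e) * (1 - q ^+ e.+1) * u e.+1.
  by rewrite ipoch_subSS (_ : n = r + e)%N ?ipoch_sub_recr 1?ipochS; [ring | lia].
rewrite (_ : n = r + e)%N; last by lia.
rewrite (exprS _ r.+1) (exprS _ r).
rewrite !mul2n -!addnn -?addnS !(exprD, exprS) !expr0; ring.
Qed.

(** The function [bailey_cert n] extends to an even function of r, and this is
    the vanishing of its sum over all integers.  After multiplication by
    1 - q^n the summand telescopes, for n >= 1. *)
Lemma bailey_cert_sum n :
  bailey_cert n.+1 0 + 2 * \sum_(r < n.+1) bailey_cert n.+1 r.+1 = 0.
Proof.
pose t r := (-1) ^+ r * q ^+ 'C(r, 2) * ipoch_sub n.+1 r * u (n + r).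
have tE r : (1 - q ^+ n.+1) * bailey_cert n.+1 r = q ^+ n.+1 * (t r - t r.+1).
  case: (leqP r n.+1) => [le_rn|gt_rn]; last first.
    by rewrite /t /bailey_cert !ipoch_sub_gt //; [ring | lia].
  have [e en] : exists e, n.+1 = (r + e)%N by exists (n.+1 - r)%N; lia.
  rewrite /t /bailey_cert bin2S.
  have -> : ipoch_sub n.+1 r = u e by rewrite en ipoch_sub_add.
  have -> : ipoch_sub n.+1 r.+1 = (1 - q ^+ e) * u e by rewrite en ipoch_sub_recr.
  have -> : u (n + r) = (1 - q ^+ (n.+1 + r)) * u (n.+1 + r).
    by rewrite ipochS; congr ((1 - q ^+ _) * u _); lia.
  have -> : (n + r.+1 = n.+1 + r)%N by lia.
  rewrite en !(exprD, exprS); ring.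
have sumE N : (1 - q ^+ n.+1) * \sum_(r < N) bailey_cert n.+1 r.+1 =
              q ^+ n.+1 * (t 1 - t N.+1).
  elim: N => [|N IHN]; first by rewrite big_ord0; ring.
  by rewrite big_ord_recr /= mulrDr IHN tE; ring.
apply: (@one_sub_qX_cancel n); rewrite mulrDr (mulrCA _ 2) sumE mulr0.
rewrite /t /bailey_cert (@ipoch_sub_gt _ n.+2) // ipoch_sub0 ipoch_subSS ipoch_sub0 addn0 addn1.
rewrite (ipochS n) /=; ring.
Qed.

(** Both sides satisfy (1 + q^n) (1 - q^(2n+1)) b_n = b_(n-1): for the left side
    this is the certificate, summed by parts, where all boundary terms vanish. *)
Lemma bailey_pair n :
  \sum_(r < n.+1) bailey_term n r * hecke_inner q r = poch q q n * u (n + n).+1.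
Proof.
elim: n => [|n IHn].
  rewrite big_ord1 hecke_inner0 /bailey_term ipoch_sub0 /poch big_ord0 (ipochS 1) ipoch0 /=; ring.
apply: (@one_sub_qX_cancel (n + n).+2); apply: (@one_sub_qX_cancel (n + n).+1).
set X := \sum_(r < _) _.
have XE : (1 + q ^+ n.+1) * (1 - q ^+ (2 * n + 3)) * X =
          \sum_(r < n.+1) bailey_term n r * hecke_inner q r.
  have wn0 : bailey_term n n.+1 = 0 by rewrite /bailey_term ipoch_sub_gt // mulr0 mul0r.
  have -> : \sum_(r < n.+1) bailey_term n r * hecke_inner q r =
            \sum_(r < n.+2) bailey_term n r * hecke_inner q r.
    by rewrite [RHS]big_ord_recr /= wn0 mul0r addr0.
  apply/eqP; rewrite -subr_eq0 mulr_sumr -sumrB.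
  under eq_bigr => r _ do rewrite mulrA -mulrBl bailey_term_cert.
  rewrite hecke_inner_abel bailey_cert_sum /bailey_cert !ipoch_sub_gt //; apply/eqP; ring.
have nS : q ^+ (n + n).+2 = q ^+ n.+1 * q ^+ n.+1 by rewrite -exprD addnS addSn.
have := XE; rewrite IHn pochS -exprS (ipochS (n + n).+1) (ipochS (n + n).+2) nS.
rewrite (_ : 2 * n + 3 = (n + n).+3)%N; last by lia.
rewrite (_ : (n.+1 + n.+1).+1 = (n + n).+3)%N; last by lia.
move: (q ^+ n.+1) (q ^+ (n + n).+3) (poch q q n) (u _) => a b p v E.
have {}E : (1 - a) * ((1 + a) * (1 - b) * X) = (1 - a) * (p * ((1 - a * a) * ((1 - b) * v))).
  by rewrite E.
transitivity ((1 - a) * ((1 + a) * (1 - b) * X)); first by ring.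
by rewrite E; ring.
Qed.

(** The index n stands for m - 1, where m >= 1 is the summation index of the
    q-Gauss sum. *)
Definition conj_term k n : R :=
  (1 - q ^+ (2 * k)) * (- q) ^+ n.+1 * poch (q ^+ 2) (q ^+ 2) n
  * ipoch_sub n.+1 k * u (n.+1 + k).

Definition conj_cert k n : R :=
  (- q) ^+ n.+1 * poch (q ^+ 2) (q ^+ 2) n * ipoch_sub n k * u (n.+1 + k).

(** A telescoping (Wilf-Zeilberger) certificate: it expresses the sum for k + 1
    as - q times the sum for k. *)
Lemma conj_term_cert k n :
  q * conj_term k n + conj_term k.+1 n =
  (1 - q ^+ (2 * k).+1) * (conj_cert k n - conj_cert k n.+1).
Proof.
rewrite /conj_term /conj_cert ipoch_subSS pochS -exprS -exprM.
case: (leqP k n.+1) => [le_kn|gt_kn]; last first.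
  by rewrite !ipoch_sub_gt //; [ring | lia].
have [e en] : exists e, n.+1 = (k + e)%N by exists (n.+1 - k)%N; lia.
have -> : ipoch_sub n k = (1 - q ^+ e) * u e by rewrite -ipoch_subSS en ipoch_sub_recr.
have -> : ipoch_sub n.+1 k = u e by rewrite en ipoch_sub_add.
have -> : u (n.+1 + k) = (1 - q ^+ (n.+1 + k).+1) * u (n.+2 + k) by rewrite ipochS.
have -> : (n.+1 + k.+1 = n.+2 + k)%N by lia.
rewrite (exprS (- q) n.+1); move: ((- q) ^+ _) (poch _ _ _) (u _) (u _) => x p v w.
rewrite en mulnS !mulnDr !mul2n -!addnn !(exprD, exprS) !expr0.
ring.
Qed.

(** The sum for k = 0 has no nonzero term, but there the boundary term at n = 0
    supplies the value - q for k = 1; for larger k no boundary term is left. *)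
Lemma conjugate_bailey_pair k M :
  q ^+ M.+1 = 0 -> \sum_(n < M) conj_term k.+1 n = (- q) ^+ k.+1.
Proof.
move=> qM0.
have step i : \sum_(n < M) conj_term i.+1 n =
    - q * (\sum_(n < M) conj_term i n) + (1 - q ^+ (2 * i).+1) * conj_cert i 0.
  have tele N : \sum_(n < N) (q * conj_term i n + conj_term i.+1 n) =
                (1 - q ^+ (2 * i).+1) * (conj_cert i 0 - conj_cert i N).
    elim: N => [|N IHN]; first by rewrite big_ord0; ring.
    by rewrite big_ord_recr /= IHN conj_term_cert; ring.
  have := tele M; rewrite big_split /= -mulr_sumr.
  have -> : conj_cert i M = 0 by rewrite /conj_cert exprNn qM0 mulr0 !mul0r.
  by rewrite subr0 => <-; ring.
elim: k => [|k IHk].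
  rewrite step big1 => [|n _]; last by rewrite /conj_term expr0 subrr !mul0r.
  have := ipochS 0; rewrite ipoch0 => u1.
  by rewrite /conj_cert ipoch_sub0 ipoch0 /poch big_ord0 -[RHS]mulr1 [in RHS]u1; ring.
by rewrite step IHk /conj_cert ipoch_sub_gt // mulr0 mul0r mulr0 addr0 -exprS.
Qed.

(** Exchanging the two summations after [bailey_pair] makes the inner sum the one
    of [conjugate_bailey_pair]. *)
Lemma truncated_hecke_identity M :
  q ^+ M.+1 = 0 ->
  \sum_(n < M) (- q) ^+ n.+1 * poch q q n * poch (q ^+ 2) (q ^+ 2) n * u (n + n).+1
  = - \sum_(r < M) q ^+ 'C(r.+2, 2) * hecke_inner q r.
Proof.
move=> qM0.
transitivity (\sum_(n < M) \sum_(r < M)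
    (-1) ^+ r * q ^+ 'C(r.+1, 2) * hecke_inner q r * conj_term r.+1 n).
  apply: eq_bigr => n _.
  rewrite (mulrAC _ (poch q q n)) -(mulrA _ (poch q q n)) -bailey_pair.
  rewrite [RHS](bigID (fun r : 'I_M => (r < n.+1)%N)) /=.
  rewrite [X in _ = _ + X]big1 ?addr0 => [|r]; last first.
    by rewrite -leqNgt => ltnr; rewrite /conj_term ipoch_subSS ipoch_sub_gt // mulr0 mul0r mulr0.
  rewrite -(big_ord_widen M
    (fun r => (-1) ^+ r * q ^+ 'C(r.+1, 2) * hecke_inner q r * conj_term r.+1 n)) //.
  rewrite mulr_sumr; apply: eq_bigr => r _; rewrite /bailey_term /conj_term ipoch_subSS.
  have -> : (n.+1 + r.+1 = n + r + 2)%N by lia.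
  have -> : (2 * r.+1 = 2 * r + 2)%N by lia.
  ring.
rewrite exchange_big /= -sumrN; apply: eq_bigr => r _.
rewrite -mulr_sumr conjugate_bailey_pair // (exprNn q) (bin2S r.+1) exprD.
have sgn2 : (-1) ^+ r * (-1) ^+ r = 1 :> R by rewrite -expr2 sqrr_sign.
rewrite -[RHS]mul1r -[X in _ = X * _]sgn2 (exprS (-1)); ring.
Qed.

End InversePochhammer.

(** * Truncated power series and the coefficients of f_6 *)

Section Truncation.
Variable M : nat.
Local Notation T := {poly %/ ('X^(M.+1) : {poly int})}.

Lemma in_qpolyXnE (p : {poly int}) :
  in_qpoly 'X^(M.+1) p = take_poly M.+1 p :> {poly int}.
Proof. by rewrite /= mk_monic_Xn Pdiv.RingMonic.take_poly_rmodp. Qed.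

Lemma coef_in_qpolyXn (p : {poly int}) i :
  (i <= M)%N -> (in_qpoly 'X^(M.+1) p)`_i = p`_i.
Proof. by move=> iM; rewrite in_qpolyXnE coef_take_poly ltnS iM. Qed.

Lemma in_qpolyXn_ext (p r : {poly int}) :
  (forall i, (i <= M)%N -> p`_i = r`_i) ->
  in_qpoly 'X^(M.+1) p = in_qpoly 'X^(M.+1) r.
Proof.
move=> pr; apply: val_inj; rewrite /= !mk_monic_Xn -!Pdiv.RingMonic.take_poly_rmodp /=.
by apply/polyP => i; rewrite !coef_take_poly; case: ltnP => // /pr.
Qed.

(** Reduction of a power series modulo q^(M+1); a ring morphism onto a quotient
    of Z[X] that keeps the coefficients up to q^M. *)
Definition trunc (f : fps) : T := in_qpoly 'X^(M.+1) (\poly_(i < M.+1) f i).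

Lemma coef_trunc f i : (i <= M)%N -> (trunc f)`_i = f i.
Proof. by move=> iM; rewrite coef_in_qpolyXn // coef_poly ltnS iM. Qed.

Lemma trunc_of_poly p : trunc (fps_of_poly p) = in_qpoly 'X^(M.+1) p.
Proof. by apply: in_qpolyXn_ext => i iM; rewrite coef_poly ltnS iM. Qed.

Lemma trunc_mul f g : trunc (fps_mul f g) = trunc f * trunc g.
Proof.
rewrite -in_qpolyM; apply: in_qpolyXn_ext => i iM.
rewrite coef_poly ltnS iM coefM; apply: eq_bigr => j _.
by rewrite !coef_poly !ltnS (leq_trans (leq_subr _ _) iM)
  (leq_trans _ iM) // -ltnS.
Qed.

Lemma trunc_one : trunc fps_one = 1.
Proof.
rewrite -in_qpoly1; apply: in_qpolyXn_ext => i iM.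
by rewrite coef_poly ltnS iM coef1.
Qed.

Lemma in_qpolyX_nilpotent : (in_qpoly 'X^(M.+1) 'X : T) ^+ M.+1 = 0.
Proof.
rewrite -rmorphXn /= -(in_qpoly0 'X^(M.+1)); apply: in_qpolyXn_ext => i iM.
by rewrite coefXn coef0 ltn_eqF.
Qed.

Lemma in_qpoly_qpoch a q n :
  in_qpoly 'X^(M.+1) (qpoch a q n) =
  poch (in_qpoly 'X^(M.+1) a : T) (in_qpoly 'X^(M.+1) q) n.
Proof.
rewrite /qpoch rmorph_prod; apply: eq_bigr => j _.
by rewrite rmorphB rmorph1 rmorphM rmorphXn.
Qed.

End Truncation.

Lemma qpoch_coef0 n : (qpoch 'X 'X n)`_0 = 1.
Proof.
rewrite -horner_coef0 /qpoch horner_prod big1 // => j _.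
by rewrite !hornerE.
Qed.

Definition trunc_inv_qpoch M n := trunc M (fps_inv (fps_of_poly (qpoch 'X 'X n))).

Lemma trunc_inv_qpochK M n :
  trunc_inv_qpoch M n *
  poch (in_qpoly 'X^(M.+1) 'X) (in_qpoly 'X^(M.+1) 'X) n = 1.
Proof.
rewrite -in_qpoly_qpoch -trunc_of_poly -trunc_mul fps_mul_inv ?trunc_one //.
by rewrite /fps_of_poly qpoch_coef0 unitr1.
Qed.

Lemma trunc_f6_term M n :
  let q := in_qpoly 'X^(M.+1) ('X : {poly int}) in
  trunc M (f6_term n.+1) =
  (- q) ^+ n.+1 * poch q q n * poch (q ^+ 2) (q ^+ 2) n
  * trunc_inv_qpoch M (n + n).+1.
Proof.
move=> q; rewrite /f6_term (_ : (2 * n.+1).-1 = (n + n).+1); last by lia.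
rewrite trunc_mul trunc_of_poly !rmorphM !rmorphXn /=.
rewrite -/q !in_qpoly_qpoch rmorphXn -/q (rmorphN1 (in_qpoly _)).
by rewrite -/(trunc_inv_qpoch M _) (exprNn q); ring.
Qed.

Lemma f6_term_coef_small n k : (k < n)%N -> f6_term n k = 0.
Proof.
move=> kn; rewrite /f6_term /fps_mul big1 // => i _.
rewrite /fps_of_poly coefMXn (leq_ltn_trans _ kn) ?mul0r //.
by rewrite -ltnS.
Qed.

Lemma f6_summable : fps_summable [set n | (1 <= n)%N] f6_term.
Proof.
move=> k; apply: (sub_finite_set (B := `I_k.+1)); last exact: finite_II.
move=> n /= [_ nz]; rewrite ltnS leqNgt; apply/negP => kn.
by apply: nz; exact: f6_term_coef_small.
Qed.

Lemma f6E M : f6 M = \sum_(n < M) f6_term n.+1 M.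
Proof.
rewrite /f6 /fps_sum (fsbigE (index_iota 1 M.+1)) ?iota_uniq //.
- rewrite big_seq_cond (eq_bigl (mem (index_iota 1 M.+1))); last first.
    move=> i /=; case: (boolP (i \in _)) => //=.
    by rewrite mem_index_iota => /andP[i1 _]; apply/mem_set.
  by rewrite -big_seq big_add1 big_mkord.
- by move=> i /=; rewrite mem_index_iota => /andP[].
- move=> i /= i1; rewrite mem_index_iota i1 /= -leqNgt => Mi.
  exact: f6_term_coef_small.
Qed.

Lemma f6_coef M :
  f6 M = - \sum_(r < M) \sum_(j < r.+1) (M == 'C(r.+2, 2) + j * (r - j))%N%:R.
Proof.
pose q := in_qpoly 'X^(M.+1) ('X : {poly int}).
have E : trunc M (fun k => \sum_(n < M) f6_term n.+1 k) =
    in_qpoly 'X^(M.+1)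
      (- \sum_(r < M) \sum_(j < r.+1) 'X^('C(r.+2, 2) + j * (r - j))).
  transitivity (\sum_(n < M) trunc M (f6_term n.+1)).
    rewrite -rmorph_sum; apply: in_qpolyXn_ext => i iM.
    rewrite coef_sum coef_poly ltnS iM; apply: eq_bigr => n _.
    by rewrite coef_poly ltnS iM.
  under eq_bigr do rewrite trunc_f6_term.
  rewrite (truncated_hecke_identity (trunc_inv_qpochK M)); last first.
    exact: in_qpolyX_nilpotent.
  rewrite rmorphN rmorph_sum; congr (- _); apply: eq_bigr => r _ /=.
  rewrite rmorph_sum mulr_sumr; apply: eq_bigr => j _ /=.
  by rewrite -exprD rmorphXn.
have := congr1 (fun p : {poly %/ ('X^(M.+1) : {poly int})} => p`_M) E.
rewrite coef_trunc // coef_in_qpolyXn // f6E => ->.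
rewrite coefN coef_sum; congr (- _); apply: eq_bigr => r _.
by rewrite coef_sum; apply: eq_bigr => j _; rewrite coefXn.
Qed.

(** The terms of exponent m in the double series; p is (r, j). *)
Definition hecke_pairs (m : nat) : set (nat * nat) :=
  [set p | (p.2 <= p.1)%N /\ m = ('C(p.1.+2, 2) + p.2 * (p.1 - p.2))%N].

Lemma hecke_pairs_bound m p :
  hecke_pairs m p -> (p.1 < m)%N /\ (p.2 < m)%N.
Proof.
case=> le21 ->; have : (p.1 < 'C(p.1.+2, 2))%N by rewrite binS bin1; lia.
move: (p.2 * _)%N ('C(_, _)) le21 => a b; lia.
Qed.

Lemma finite_hecke_pairs m : finite_set (hecke_pairs m).
Proof.
apply: (sub_finite_set (B := `I_m `*` `I_m)); last exact: finite_setX.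
by move=> p /hecke_pairs_bound[].
Qed.

Lemma f6_coef_hecke m : f6 m = - \sum_(p \in hecke_pairs m) (1 : int).
Proof.
rewrite f6_coef; congr (- _).
transitivity (\sum_(r < m) \sum_(j < m)
    if (r : nat, j : nat) \in hecke_pairs m then 1 else 0 : int).
  apply: eq_bigr => r _; rewrite -big_mkcond.
  rewrite (big_ord_widen_cond m xpredT
    (fun j => (m == 'C(r.+2, 2) + j * (r - j))%N%:R : int)) //.
  rewrite [RHS]big_mkcond [LHS]big_mkcond /=; apply: eq_bigr => j _.
  rewrite ltnS; case: ifP => [jr|jr].
    case: eqP => mE.
      by rewrite mem_set.
    by rewrite memNset // => -[].
  by rewrite memNset // => -[] /=; rewrite jr.
rewrite (fsbig_ord _ _ (fun r => \sum_(j < m)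
  if (r, j : nat) \in hecke_pairs m then 1 else 0)).
under eq_fsbigr => r _ do rewrite (fsbig_ord _ _
  (fun j => if (r, j) \in hecke_pairs m then 1 else 0)).
rewrite pair_fsbig //=.
under eq_fsbigr => p _ do rewrite -surjective_pairing.
rewrite -fsbig_mkcondr; apply: eq_fsbigl; apply/seteqP; split=> p /=; first by case.
by move=> Sp; split=> //; exact: hecke_pairs_bound.
Qed.


(** * Integer arithmetic *)

(** Parity of the 3-adic valuation. *)
Lemma sqr_eq_3sqr_int (a b : int) : a * a = 3 * (b * b) -> b = 0.
Proof.
move=> ab; apply/eqP; rewrite -absz_eq0; apply/eqP.
have {ab} := congr1 absz ab; rewrite !abszM.
move: `|a|%N `|b|%N => {}a {}b=> ab.
have {}ab : (a * a = 3 * (b * b))%N := ab.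
case: b ab => // b ab; have a_gt0 : (0 < a)%N by lia.
have := congr1 (logn 3) ab; rewrite !lognM // (_ : logn 3 3 = 1%N) // => /(congr1 odd).
by rewrite !oddD !addbb.
Qed.

Lemma sqr_eq_3sqr_rat (a b : rat) : a * a = 3 * (b * b) -> b = 0.
Proof.
rewrite -(divq_num_den a) -(divq_num_den b).
move: (numq a) (denq a) (numq b) (denq b) (denq_neq0 a) (denq_neq0 b).
move=> a1 a2 b1 b2 a2n b2n.
have a2n' : a2%:~R != 0 :> rat by rewrite intr_eq0.
have b2n' : b2%:~R != 0 :> rat by rewrite intr_eq0.
move=> E.
have : (a1 * b2) * (a1 * b2) = 3 * ((b1 * a2) * (b1 * a2)).
  apply: (@intr_inj rat); rewrite !rmorphM /=.
  transitivity ((a1%:~R / a2%:~R * (a1%:~R / a2%:~R)) * (a2%:~R * b2%:~R) ^+ 2 : rat).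
    by field.
  by rewrite E; field.
move=> /sqr_eq_3sqr_int /eqP; rewrite mulf_eq0 (negbTE a2n) orbF => /eqP->.
by rewrite mul0r.
Qed.

(** Z is integrally closed; this is transported from algebraic integers. *)
Lemma integral_rat_int (r : rat) :
  integralOver (intr : int -> rat) r -> exists z : int, r = z%:~R.
Proof.
case=> p p_monic rp.
have : (ratr r : algC) \in Num.int.
  apply: Cint_rat_Aint; first exact: Crat_rat.
  apply: (@root_monic_Aint (map_poly intr p)).
  - have -> : map_poly intr p = map_poly ratr (map_poly intr p : {poly rat}) :> {poly algC}.
      by rewrite -map_poly_comp; apply: eq_map_poly => z /=; rewrite ratr_int.
    by rewrite fmorph_root.
  - exact: monic_map.
  - by apply/polyOverP => i; rewrite coef_map /= intr_int.
move=> /intrP[z rz]; exists z; apply: (fmorph_inj (@ratr algC)).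
by rewrite [RHS]ratr_int; exact: rz.
Qed.

Lemma int_parity (z : int) : exists y, z = 2 * y \/ z = 2 * y + 1.
Proof.
exists (z %/ 2)%Z; have := divz_eq z 2; have := ltz_pmod z (isT : 0 < (2 : int)).
by have := modz_ge0 z (isT : (2 : int) != 0); lia.
Qed.

(** * The norm form of Z[s] *)

(** The norm of x + y s when s^2 = 3. *)
Definition qnorm (x y : int) : int := x * x - 3 * (y * y).

Lemma qnormM c d x y :
  qnorm (c * x + 3 * (d * y)) (c * y + d * x) = qnorm c d * qnorm x y.
Proof. by rewrite /qnorm; ring. Qed.

Lemma qnorm_eq0 x y : qnorm x y = 0 -> x = 0 /\ y = 0.
Proof.
move=> /eqP; rewrite subr_eq0 => /eqP E.
have y0 := sqr_eq_3sqr_int E; move: E; rewrite y0 !mulr0 => /eqP.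
by rewrite mulf_eq0 orbb => /eqP.
Qed.

Lemma round_div (p n : int) : n != 0 ->
  exists c, 2 * `|p - c * n| <= `|n|.
Proof.
move=> n0; have := divz_eq p n; have := modz_ge0 p n0; have := ltz_mod p n0.
move: (p %/ n)%Z (p %% n)%Z => c r lt_r r0 ->.
have [le|gt] := lerP (2 * r) `|n|.
  by exists c; lia.
have [n_gt0|n_le0] := ltrP 0 n; [exists (c + 1) | exists (c - 1)].
  by rewrite (_ : c * n + r - (c + 1) * n = r - n); [lia | ring].
by rewrite (_ : c * n + r - (c - 1) * n = r + n); [lia | ring].
Qed.

(** Division of p + r s by a = x + y s: the product of the remainder and the
    conjugate of a has coordinates U, V of absolute value at most |N a| / 2, and
    then |U^2 - 3 V^2| <= 3/4 (N a)^2. *)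
Lemma qnorm_euclid p r x y : qnorm x y != 0 -> exists c d,
  (`|qnorm (p - (c * x + 3 * (d * y))) (r - (c * y + d * x))| < `|qnorm x y|)%N.
Proof.
move=> N0; have [c Hc] := round_div (p * x - 3 * (r * y)) N0.
have [d Hd] := round_div (r * x - p * y) N0.
exists c, d.
set e := p - _; set f := r - _.
have E : qnorm e f * qnorm x y =
    (p * x - 3 * (r * y) - c * qnorm x y) * (p * x - 3 * (r * y) - c * qnorm x y)
    - 3 * ((r * x - p * y - d * qnorm x y) * (r * x - p * y - d * qnorm x y)).
  by rewrite /e /f /qnorm; ring.
move: (qnorm e f) (qnorm x y) (p * x - 3 * (r * y) - c * _) (r * x - p * y - d * _)
  N0 Hc Hd E => w n U V N0 Hc Hd E.
have U2 : 4 * (U * U) <= n * n by nia.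
have V2 : 4 * (V * V) <= n * n by nia.
have W1 : 4 * (w * n) <= n * n by rewrite E; nia.
have W2 : - 3 * (n * n) <= 4 * (w * n) by rewrite E; nia.
have n2 : 0 < n * n by nia.
rewrite ltnNge; apply/negP => le_nw.
nia.
Qed.

Lemma qnorm_neq_3mod4 x y (m : int) : qnorm x y <> 4 * m - 1.
Proof.
rewrite /qnorm => E.
have [[x' Ex] [y' Ey]] := (int_parity x, int_parity y); move: E.
by case: Ex Ey => -> [] -> E; lia.
Qed.

Lemma qnorm_1mod4_parity x y (m : int) :
  qnorm x y = 1 - 4 * m -> exists j, y - 1 - x = 2 * j.
Proof.
rewrite /qnorm => E.
have [[x' Ex] [y' Ey]] := (int_parity x, int_parity y); move: E.
case: Ex Ey => -> [] -> E; do 1?[exfalso; lia].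
  by exists (y' - x'); lia.
by exists (y' - x' - 1); lia.
Qed.

(** A unit c + d s of norm 1 with c > 0 and d > 0 has d < c <= 2 d, which makes
    it map the cone |x| < y into x >= y; for d < 0 the image is in x <= - y, and
    for c < 0 it has y < 0. *)
Lemma unit_domain_unique c d x y :
  qnorm c d = 1 -> `|x| < y ->
  `|c * x + 3 * (d * y)| < c * y + d * x -> c = 1 /\ d = 0.
Proof.
rewrite /qnorm => N1 dom dom'.
have [d0|d0] := eqVneq d 0.
  split=> //; move: N1 dom'; rewrite d0 => N1 dom'.
  have [->//|] : c = 1 \/ c = -1 by nia.
  by move=> c1; exfalso; rewrite c1 in dom'; lia.
exfalso.
have c2 : c * c <= 4 * (d * d) by nia.
have c3 : d * d < c * c by nia.
have [c_gt0|c_le0] := ltrP 0 c; last first.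
  have : `|d| < - c by nia.
  move=> dc; nia.
have [d_gt0|d_le0] := ltrP 0 d.
  have cd : c <= 2 * d by nia.
  have dc : d < c by nia.
  have : c * x + 3 * (d * y) < c * y + d * x by lia.
  nia.
have cd : c <= 2 * - d by nia.
have dc : - d < c by nia.
have : - (c * x + 3 * (d * y)) < c * y + d * x by lia.
nia.
Qed.

(** * The ring of integers of Q(s) *)

Section QuadraticField.
Variables (L : fieldExtType rat) (s : L).
Hypothesis Ls : is_Q_sqrt3 s.

Definition qelt (a b : rat) : L := a%:A + b%:A * s.
Definition elt (a b : int) : L := a%:~R + b%:~R * s.

Lemma qelt_int a b : qelt a%:~R b%:~R = elt a b.
Proof. by rewrite /qelt /elt -!in_algE !rmorph_int. Qed.

Lemma sqr_s : s * s = 3.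
Proof. by case: Ls => + _; rewrite expr2. Qed.

Lemma qeltD a b c d : qelt a b + qelt c d = qelt (a + c) (b + d).
Proof. by rewrite /qelt -!in_algE !rmorphD; ring. Qed.

Lemma qeltM a b c d :
  qelt a b * qelt c d = qelt (a * c + 3 * (b * d)) (a * d + b * c).
Proof.
rewrite /qelt -!in_algE !(rmorph_nat, rmorphD, rmorphM) -sqr_s.
by ring.
Qed.

Lemma qelt_eq0 a b : qelt a b = 0 -> a = 0 /\ b = 0.
Proof.
move=> E; have aE : a%:A = - (b%:A * s) :> L by apply/eqP; rewrite -addr_eq0 -/(qelt a b) E.
have b0 : b = 0.
  apply: (@sqr_eq_3sqr_rat a); apply: (fmorph_inj (in_alg L)).
  rewrite !(rmorph_nat, rmorphM) -sqr_s /= aE; ring.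
split=> //; apply: (fmorph_inj (in_alg L)).
by rewrite rmorph0 /= aE b0 scale0r mul0r oppr0.
Qed.

Lemma qelt_inj a b c d : qelt a b = qelt c d -> a = c /\ b = d.
Proof.
move=> E; have : qelt (a - c) (b - d) = 0.
  by rewrite -qeltD E -[RHS](subrr (qelt c d)) {3}/qelt /qelt !scaleNr mulNr opprD.
by case/qelt_eq0 => /eqP + /eqP; rewrite !subr_eq0 => /eqP -> /eqP ->.
Qed.

Lemma elt_inj a b c d : elt a b = elt c d -> a = c /\ b = d.
Proof. by rewrite -!qelt_int => /qelt_inj[/intr_inj -> /intr_inj ->]. Qed.

(** Elements of the field are polynomials in s, and s^2 = 3. *)
Lemma qelt_surj x : exists a b, x = qelt a b.
Proof.
have : x \in <<1; s>>%VS by case: Ls => _ ->; exact: memvf.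
case/Fadjoin_polyP => p /polyOverP p1 ->.
elim/poly_ind: p p1 => [|p c IHp] p1.
  by exists 0, 0; rewrite horner0 /qelt !scale0r mul0r addr0.
have [|a [b E]] := IHp.
  by move=> i; have := p1 i.+1; rewrite coefD coefMX coefC /= addr0.
have /vlineP[k ck] : c \in 1%VS by have := p1 0; rewrite coefD coefMX coefC /= add0r.
exists (3 * b + k), a; rewrite !hornerE E ck.
have -> : s = qelt 0 1 by rewrite /qelt scale0r add0r scale1r mul1r.
have -> : k%:A = qelt k 0 by rewrite /qelt scale0r mul0r addr0.
by rewrite qeltM qeltD; congr qelt; ring.
Qed.

(** Conjugation a + b s |-> a - b s commutes with integer polynomials. *)
Lemma horner_qelt_conj (p : {poly int}) a b : exists c d,
  (map_poly intr p).[qelt a b] = qelt c d /\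
  (map_poly intr p).[qelt a (- b)] = qelt c (- d).
Proof.
elim/poly_ind: p => [|p k [c [d [IH1 IH2]]]].
  by exists 0, 0; rewrite map_poly0 !horner0 /qelt oppr0 !scale0r mul0r addr0.
exists (c * a + 3 * (d * b) + k%:~R), (c * b + d * a).
have kE : k%:~R = qelt k%:~R 0 by rewrite /qelt scale0r mul0r addr0 -in_algE rmorph_int.
rewrite rmorphD rmorphM /= map_polyX map_polyC /= !hornerMXaddC IH1 IH2 kE.
by rewrite !qeltM !qeltD; split; congr qelt; ring.
Qed.

Lemma integral_conj a b :
  integralOver (intr : int -> L) (qelt a b) ->
  integralOver (intr : int -> L) (qelt a (- b)).
Proof.
case=> p p_monic /eqP rp; exists p => //; apply/eqP.
have [c [d [E1 ->]]] := horner_qelt_conj p a b.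
move: rp; rewrite E1 => /qelt_eq0[-> ->].
by rewrite /qelt oppr0 !scale0r mul0r addr0.
Qed.

Lemma integral_qelt_int (r : rat) :
  integralOver (intr : int -> L) (qelt r 0) -> exists z : int, r = z%:~R.
Proof.
case=> p p_monic rp; apply: integral_rat_int; exists p => //.
have E : map_poly intr p = map_poly (in_alg L) (map_poly intr p) :> {poly L}.
  by rewrite -map_poly_comp; apply: eq_map_poly => z; rewrite /= -in_algE rmorph_int.
by rewrite -(fmorph_root (in_alg L)) -E /= -[_%:A]addr0 -(mul0r s) -(scale0r 1).
Qed.

Lemma integral_s : integralOver (intr : int -> L) s.
Proof.
exists ('X^2 - 3%:P); first by rewrite monicXnsubC.
by rewrite rmorphB /= map_polyXn map_polyC /= /root !hornerE; case: Ls => ->; rewrite subrr.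
Qed.

Lemma integral_elt a b : ring_of_integers L (elt a b).
Proof.
rewrite /ring_of_integers /= /elt; apply: integral_add; first exact: integral_id.
by apply: integral_mul; [exact: integral_id | exact: integral_s].
Qed.

(** For x = a + b s integral, the rational numbers 2 a, a^2 - 3 b^2 and 6 b are
    integral over Z, being x + x', x x' and (x - x') s for the conjugate x'.  So
    u = 2 a and w = 6 b are integers with 3 u^2 - w^2 = 12 n; then w = 3 t, and
    u^2 - 3 t^2 = 4 n makes u and t even. *)
Lemma ring_of_integersE x : ring_of_integers L x -> exists a b, x = elt a b.
Proof.
have [a [b ->]] := qelt_surj x; rewrite /ring_of_integers /= => int_x.
have int_y := integral_conj int_x.
have [u aE] : exists u : int, a + a = u%:~R.
  by apply: integral_qelt_int; have := integral_add int_x int_y; rewrite qeltD subrr.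
have [n nE] : exists n : int, a * a - 3 * (b * b) = n%:~R.
  apply: integral_qelt_int; have := integral_mul int_x int_y; rewrite qeltM.
  by congr integralOver; congr qelt; ring.
have [w wE] : exists w : int, 6 * b = w%:~R.
  apply: integral_qelt_int.
  have := integral_mul (integral_sub int_x int_y) integral_s.
  have -> : s = qelt 0 1 by rewrite /qelt scale0r add0r scale1r mul1r.
  have -> : qelt a b - qelt a (- b) = qelt 0 (b + b).
    by apply/eqP; rewrite subr_eq qeltD; apply/eqP; congr qelt; ring.
  by rewrite qeltM; congr integralOver; congr qelt; ring.
have E : 3 * (u * u) - w * w = 12 * n.
  by apply: (@intr_inj rat); rewrite !(rmorphM, rmorphB) /= -aE -nE -wE; ring.
have [t tE] : exists t, w = 3 * t.
  have : (3 %| w * w)%Z by apply/dvdzP; exists (u * u - 4 * n); lia.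
  rewrite dvdzE abszM (Euclid_dvdM _ _ (isT : prime 3)) orbb => w3.
  have /dvdzP[t ->] : (3 %| w)%Z by rewrite dvdzE.
  by exists t; rewrite mulrC.
have {}E : u * u - 3 * (t * t) = 4 * n by rewrite tE in E; lia.
have [[u' u'E] [t' t'E]] : (exists u', u = 2 * u') /\ (exists t', t = 2 * t').
  have [[u' Eu] [t' Et]] := (int_parity u, int_parity t); move: E.
  case: Eu Et => -> [] -> E; do 1?[exfalso; lia].
  by split; [exists u' | exists t'].
exists u', t'; rewrite -qelt_int; congr qelt.
  by move: aE; rewrite u'E rmorphM /= => aE; lra.
by move: wE; rewrite tE t'E !rmorphM /= => wE; lra.
Qed.

(** * Ideals of the ring of integers *)

Lemma eltM a b c d :
  elt a b * elt c d = elt (a * c + 3 * (b * d)) (a * d + b * c).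
Proof. by rewrite -!qelt_int qeltM !(rmorphD, rmorphM). Qed.

Lemma eltD a b c d : elt a b + elt c d = elt (a + c) (b + d).
Proof. by rewrite -!qelt_int qeltD !rmorphD. Qed.

Lemma eltN a b : - elt a b = elt (- a) (- b).
Proof. by rewrite /elt !rmorphN /=; ring. Qed.

Lemma elt0 : elt 0 0 = 0.
Proof. by rewrite /elt rmorph0 mul0r addr0. Qed.

Definition princ_ideal (x y : int) : set L :=
  [set z | exists c d, z = elt c d * elt x y].

Lemma in_princ_ideal x y u v : princ_ideal x y (elt u v) <->
  exists c d, u = c * x + 3 * (d * y) /\ v = c * y + d * x.
Proof.
split=> [[c [d]]|[c [d [-> ->]]]]; last by exists c, d; rewrite eltM.
by rewrite eltM => /elt_inj[-> ->]; exists c, d.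
Qed.

Lemma princ_ideal_is_ideal x y : is_ideal (princ_ideal x y).
Proof.
split.
- by move=> z [c [d ->]]; rewrite eltM; exact: integral_elt.
- by exists 0, 0; rewrite elt0 mul0r.
- move=> _ _ [c [d ->]] [c' [d' ->]].
  by exists (c + c'), (d + d'); rewrite -(eltD c d) [RHS]mulrDl.
- move=> r _ /ring_of_integersE[u [v ->]] [c [d ->]].
  by exists (u * c + 3 * (v * d)), (u * d + v * c); rewrite [LHS]mulrA (eltM u v c d).
Qed.

Lemma mem_princ_ideal x y : princ_ideal x y (elt x y).
Proof. by exists 1, 0; rewrite /elt rmorph1 rmorph0 mul0r addr0 mul1r. Qed.

Lemma princ_ideal_neq0 x y : qnorm x y != 0 -> princ_ideal x y <> [set 0].
Proof.
move=> N0 E; have := mem_princ_ideal x y; rewrite E /= -elt0 => /elt_inj[x0 y0].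
by move: N0; rewrite x0 y0.
Qed.

Lemma idealB (a : set L) u v : is_ideal a -> a u -> a v -> a (u - v).
Proof.
move=> ida au av; apply: (idealD ida) => //.
rewrite -mulN1r; apply: (idealM ida) => //.
have -> : (-1 : L) = elt (-1) 0 by rewrite /elt rmorphN rmorph1 rmorph0 mul0r addr0.
exact: integral_elt.
Qed.

(** A nonzero element of least |norm| divides every other element, by
    [qnorm_euclid]. *)
Lemma ideal_is_principal (a : set L) : is_ideal a -> a <> [set 0] ->
  exists x y, qnorm x y != 0 /\ a = princ_ideal x y.
Proof.
move=> ida an0.
(* P is the set of absolute norms of nonzero elements. *)
pose P n := `[< exists x y, [/\ a (elt x y), qnorm x y != 0 & `|qnorm x y|%N = n] >].
have exP : exists n, P n.
  have [z az z0] : exists2 z, a z & z <> 0.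
    apply: contrapT => H; apply: an0; apply/seteqP; split=> z /=.
      by move=> az; apply: contrapT => z0; apply: H; exists z.
    by move=> ->; exact: (ideal0 ida).
  have [x [y zE]] := ring_of_integersE (ideal_sub ida az).
  exists `|qnorm x y|%N; apply/asboolP; exists x, y; split=> //; first by rewrite -zE.
  by apply/eqP => /qnorm_eq0[x0 y0]; apply: z0; rewrite zE x0 y0 elt0.
case: (ex_minnP exP) => n /asboolP[x [y [axy N0 Nn]]] nmin.
exists x, y; split=> //; apply/seteqP; split=> z; last first.
  by case=> c [d ->]; apply: (idealM ida) axy; exact: integral_elt.
move=> az; have [p [r zE]] := ring_of_integersE (ideal_sub ida az).
have [c [d lt_cd]] := qnorm_euclid p r N0.
exists c, d; apply/eqP; rewrite -subr_eq0; apply/eqP.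
have remE : z - elt c d * elt x y =
    elt (p - (c * x + 3 * (d * y))) (r - (c * y + d * x)).
  by rewrite zE eltM eltN eltD.
apply: contrapT => /eqP rem0.
have /nmin : P `|qnorm (p - (c * x + 3 * (d * y))) (r - (c * y + d * x))|%N.
  apply/asboolP; exists (p - (c * x + 3 * (d * y))), (r - (c * y + d * x)); split=> //.
    rewrite -remE; apply: idealB => //; apply: (idealM ida) axy; exact: integral_elt.
  by apply/eqP => /qnorm_eq0[e f]; move: rem0; rewrite remE e f elt0 eqxx.
by rewrite leqNgt -Nn lt_cd.
Qed.

Definition add_coset (a : set L) (z : L) : set L := [set z + y | y in a].

Lemma add_coset_eq (a : set L) z z' : is_ideal a ->
  add_coset a z = add_coset a z' <-> a (z - z').
Proof.
move=> ida; split=> [E|azz'].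
  have : add_coset a z z by exists 0; [exact: (ideal0 ida) | rewrite addr0].
  by rewrite E => -[y ay <-]; rewrite addrC addKr.
apply/seteqP; split=> _ [y ay <-].
  exists (z - z' + y); first exact: (idealD ida).
  by ring.
exists (y - (z - z')); first exact: idealB.
by ring.
Qed.

(** The Hermite basis (e, h + g s) of the lattice generated by x + y s and
    s (x + y s): g is the gcd of x and y, h comes from a Bezout relation, and e is
    |x^2 - 3 y^2| / g. *)
Lemma princ_ideal_lattice x y : qnorm x y != 0 -> exists (e g : nat) (h : int),
  [/\ (0 < e)%N, (0 < g)%N, (e * g)%N = `|qnorm x y|%N &
   forall u v, princ_ideal x y (elt u v) <->
     exists k l, u = k * h + l * e%:Z /\ v = k * g%:Z].
Proof.
move=> N0; have [d0 [c0 bez]] := Bezoutz x y.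
have /dvdzP[x' xE] := dvdz_gcdl x y; have /dvdzP[y' yE] := dvdz_gcdr x y.
have g_ge0 : 0 <= gcdz x y by [].
move: (gcdz x y) bez xE yE g_ge0 => g bez xE yE g_ge0.
pose M := x' * x - 3 * (y' * y).
have NE : qnorm x y = M * g by rewrite /qnorm /M xE yE; ring.
have g0 : g != 0 by apply: contra_neq N0 => g0; rewrite NE g0 mulr0.
have M0 : M != 0 by apply: contra_neq N0 => M0; rewrite NE M0 mul0r.
have bez' : c0 * y' + d0 * x' = 1.
  by apply: (mulIf g0); rewrite mul1r -[RHS]bez xE yE; ring.
(* The sign t of M makes the lattice generator e = |M| positive. *)
have [t MT] : exists t, `|M|%N%:Z = t * M /\ t * t = 1.
  by have [M_ge0|M_lt0] := lerP 0 M; [exists 1 | exists (-1)]; split; lia.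
case: MT => MT tt.
exists `|M|%N, `|g|%N, (c0 * x + 3 * (d0 * y)); split; [lia | lia | | ].
  by rewrite -abszM NE.
move=> u v; rewrite in_princ_ideal MT gez0_abs // /M.
split=> [[c [d [-> ->]]]|[k [l [-> ->]]]].
  (* With k (h + g s) removed, the coefficients (c, d) become orthogonal to
     (y', x'); as (c0, d0) pairs to 1 with it, they are l (x', - y'). *)
  pose k := c * y' + d * x'; pose l := (c - k * c0) * d0 - c0 * (d - k * d0).
  have c1 : (c - k * c0) * y' + (d - k * d0) * x' = 0.
    transitivity (k * (1 - (c0 * y' + d0 * x'))); first by rewrite /k; ring.
    by rewrite bez' subrr mulr0.
  have cE : c - k * c0 = l * x'.
    rewrite -[LHS]mulr1 -bez' -[RHS](addr0) -[X in _ = _ + X](mulr0 c0) -c1 /l.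
    ring.
  have dE : d - k * d0 = - l * y'.
    rewrite -[LHS]mulr1 -bez' -[RHS](addr0) -[X in _ = _ + X](mulr0 d0) -c1 /l.
    ring.
  exists k, (l * t); split; last by rewrite /k xE yE; ring.
  rewrite (_ : l * t * (t * _) = (t * t) * (l * (x' * x - 3 * (y' * y)))); last by ring.
  rewrite tt mul1r -[c](subrK (k * c0)) -[d](subrK (k * d0)) cE dE; ring.
exists (k * c0 + l * t * x'), (k * d0 - l * t * y'); split; first by ring.
transitivity (k * (d0 * x + c0 * y) + l * t * (x' * y - y' * x)).
  by rewrite bez xE yE; ring.
by ring.
Qed.

Lemma card_fset_set_range (T : finType) (U : choiceType) (f : T -> U) :
  injective f -> #|` fset_set (range f)|%fset = #|T|.
Proof.
move=> f_inj; have -> : fset_set (range f) = [fset f x | x in T]%fset.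
  apply/fsetP => z; rewrite in_fset_set; last exact: finite_image.
  apply/idP/imfsetP => [/set_mem[x _ <-]|[x _ ->]]; first by exists x.
  by apply/mem_set; exists x.
by rewrite card_imfset //= cardE.
Qed.

(** The Hermite basis gives the e g coset representatives i + j s with
    0 <= i < e and 0 <= j < g. *)
Lemma ideal_norm_princ_ideal x y : qnorm x y != 0 ->
  ideal_norm (princ_ideal x y) = `|qnorm x y|%N.
Proof.
move=> N0; have [e [g [h [e_gt0 g_gt0 <- latE]]]] := princ_ideal_lattice N0.
have ida := princ_ideal_is_ideal x y.
pose rep (p : 'I_e * 'I_g) :=
  add_coset (princ_ideal x y) (elt (p.1 : nat)%:Z (p.2 : nat)%:Z).
have quotE : ideal_quotient (princ_ideal x y) = range rep.
  apply/seteqP; split=> [_ [z Oz <-]|_ [p _ <-]]; last first.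
    by exists (elt (p.1 : nat)%:Z (p.2 : nat)%:Z); first exact: integral_elt.
  have [u [v zE]] := ring_of_integersE Oz.
  have g0 : g%:Z != 0 by lia.
  have e0 : e%:Z != 0 by lia.
  pose k := (v %/ g)%Z; pose w := u - k * h; pose l := (w %/ e)%Z.
  have vE := divz_eq v g; have wE := divz_eq w e.
  have lt_e : (`|(w %% e)%Z| < e)%N by have := ltz_mod w e0; have := modz_ge0 w e0; lia.
  have lt_g : (`|(v %% g)%Z| < g)%N by have := ltz_mod v g0; have := modz_ge0 v g0; lia.
  exists (Ordinal lt_e, Ordinal lt_g) => //.
  apply/add_coset_eq => //=; rewrite !gez0_abs ?modz_ge0 // zE eltN eltD; apply/latE.
  exists (- k), (- l); split; last by rewrite {2}vE -/k; ring.
  have -> : u = w + k * h by rewrite /w subrK.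
  by rewrite {2}wE -/l; ring.
have rep_inj : injective rep.
  move=> [i j] [i' j']; rewrite /rep /= => /(add_coset_eq _ _ ida).
  rewrite eltN eltD => /latE[k [l [E1 E2]]].
  have := ltn_ord i; have := ltn_ord i'; have := ltn_ord j; have := ltn_ord j'.
  move=> jg j'g ie i'e.
  have k0 : k = 0 by nia.
  have l0 : l = 0 by rewrite k0 in E1; nia.
  by rewrite k0 l0 in E1 E2; congr pair; apply: val_inj => /=; lia.
by rewrite /ideal_norm quotE card_fset_set_range // card_prod !card_ord.
Qed.

Lemma princ_ideal_unit c d x y : qnorm c d = 1 ->
  princ_ideal (c * x + 3 * (d * y)) (c * y + d * x) = princ_ideal x y.
Proof.
move=> N1; have N1' : elt c (- d) * elt c d = 1.
  have -> : (1 : L) = elt 1 0 by rewrite /elt rmorph1 rmorph0 mul0r addr0.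
  by rewrite eltM; congr elt; [rewrite -[RHS]N1 /qnorm; ring | ring].
rewrite /princ_ideal -eltM; apply/seteqP; split=> _ [u [v ->]].
  exists (u * c + 3 * (v * d)), (u * d + v * c).
  by rewrite -(eltM u v c d) [LHS]mulrA.
exists (u * c + 3 * (v * - d)), (u * - d + v * c).
by rewrite -(eltM u v c (- d)) -[RHS]mulrA (mulrA _ _ (elt x y)) N1' mul1r.
Qed.

(** Descent on |y|: a generator outside the cone has y <= |x| < 3 y after a
    change of sign, and multiplication by 2 - s or 2 + s replaces y by
    2 y - |x|, of smaller absolute value unless |x| = y, which parity excludes. *)
Lemma princ_ideal_reduce (m : int) x y : 0 < m -> qnorm x y = 1 - 4 * m ->
  exists x' y',
    [/\ `|x'| < y', qnorm x' y' = 1 - 4 * m & princ_ideal x' y' = princ_ideal x y].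
Proof.
move=> m_gt0; have [n] := ubnP `|y|%N; elim: n x y => // n IHn x y le_yn N.
wlog y_ge0 : x y le_yn N / 0 <= y.
  move=> W; have [/W|y_lt0] := lerP 0 y; first exact.
  have [|||x' [y' [dom N' E]]] := W (- x) (- y); [lia | | lia | ].
    by rewrite -N /qnorm; ring.
  exists x', y'; split=> //; rewrite E -(@princ_ideal_unit (-1) 0 x y) //.
  by congr princ_ideal; ring.
have [|ge_xy] := ltrP `|x| y; first by exists x, y.
have xy3 : `|x| < 3 * y by move: N; rewrite /qnorm; nia.
have xNy : `|x| <> y.
  move=> xy; have xx : x * x = y * y by rewrite -xy; nia.
  by move: N; rewrite /qnorm xx; lia.
have [x_ge0|x_lt0] := lerP 0 x.
  have [||x' [y' [dom N' E]]] := IHn (2 * x + 3 * (-1 * y)) (2 * y + -1 * x).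
  - lia.
  - by rewrite qnormM N mul1r.
  by exists x', y'; split=> //; rewrite E princ_ideal_unit.
have [||x' [y' [dom N' E]]] := IHn (2 * x + 3 * (1 * y)) (2 * y + 1 * x).
- lia.
- by rewrite qnormM N mul1r.
by exists x', y'; split=> //; rewrite E princ_ideal_unit.
Qed.

(** The quotient of two generators of equal norm has norm 1, so
    [unit_domain_unique] applies. *)
Lemma princ_ideal_domain_inj x y x' y' : qnorm x y != 0 ->
  qnorm x' y' = qnorm x y ->
  `|x| < y -> `|x'| < y' -> princ_ideal x' y' = princ_ideal x y -> x' = x /\ y' = y.
Proof.
move=> N0 NN dom dom' E; have := mem_princ_ideal x' y'; rewrite E in_princ_ideal.
case=> c [d [xE yE]].
have N1 : qnorm c d = 1.
  by apply: (mulIf N0); rewrite mul1r -qnormM -xE -yE.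
have [|c1 d0] := unit_domain_unique N1 dom; first by rewrite -xE -yE.
by rewrite xE yE c1 d0 !mul0r mulr0 !addr0 !mul1r.
Qed.

(** Stated with a successor to avoid the truncated subtraction in 4 m - 1. *)
Definition ideals_norm_pred4 (m : nat) : set (set L) :=
  [set a | [/\ is_ideal a, a <> [set 0] & (ideal_norm a).+1 = (4 * m)%N]].

(** The inverse takes the generator x + y s in the cone to r = y - 1 and
    j = (y - 1 - x) / 2. *)
Lemma hecke_pairs_ideals_bij m :
  set_bij (hecke_pairs m) (ideals_norm_pred4 m)
    (fun p => princ_ideal (p.1%:Z - 2 * p.2%:Z) (p.1%:Z + 1)).
Proof.
have pairN (i j : nat) : (j <= i)%N ->
    qnorm (i%:Z - 2 * j%:Z) (i%:Z + 1) = 1 - 4 * ('C(i.+2, 2) + j * (i - j))%N%:Z.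
  move=> le_ji; have := bin_ffact i.+2 2; rewrite !ffactSS ffactn0 -[2`!%N]/2%N.
  by move: 'C(i.+2, 2) => t; rewrite /qnorm; nia.
have pairP p : hecke_pairs m p ->
    `|p.1%:Z - 2 * p.2%:Z| < p.1%:Z + 1 /\
    qnorm (p.1%:Z - 2 * p.2%:Z) (p.1%:Z + 1) = 1 - 4 * m%:Z.
  by case=> le21 mE; split; [lia | rewrite pairN // -mE].
have N0 p : hecke_pairs m p -> qnorm (p.1%:Z - 2 * p.2%:Z) (p.1%:Z + 1) != 0.
  by case/pairP => _ ->; lia.
split.
- move=> p Hp; split; [exact: princ_ideal_is_ideal | exact/princ_ideal_neq0/N0 | ].
  rewrite ideal_norm_princ_ideal; last exact: N0.
  by have [_ ->] := pairP p Hp; have [] := hecke_pairs_bound Hp; lia.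
- move=> p p' /set_mem Hp /set_mem Hp' E.
  have [dom N] := pairP p Hp; have [dom' N'] := pairP p' Hp'.
  have [|e1 e2] := princ_ideal_domain_inj (N0 p' Hp') _ dom' dom E; first by rewrite N.
  by move: p p' {Hp Hp' E dom dom' N N'} e1 e2 => [i j] [i' j'] /= e1 e2; congr pair; lia.
- move=> a [ida an0]; have [x [y [Nxy ->]]] := ideal_is_principal ida an0.
  rewrite ideal_norm_princ_ideal // => Nm.
  have m_gt0 : 0 < m%:Z :> int by lia.
  have NE : qnorm x y = 1 - 4 * m%:Z by have := @qnorm_neq_3mod4 x y m; lia.
  have [x' [y' [dom N' <-]]] := princ_ideal_reduce m_gt0 NE.
  have [j jE] := qnorm_1mod4_parity N'.
  exists (`|y' - 1|%N, `|j|%N) => /=; last by congr princ_ideal; lia.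
  have le_ji : (`|j| <= `|y' - 1|)%N by lia.
  split=> //=; have := pairN _ _ le_ji.
  rewrite (_ : `|y' - 1|%N%:Z - 2 * `|j|%N%:Z = x') 1?(_ : `|y' - 1|%N%:Z + 1 = y') ?N'; lia.
Qed.

Lemma finite_ideals_norm_pred4 m : finite_set (ideals_norm_pred4 m).
Proof.
have [_ _ surj] := hecke_pairs_ideals_bij m.
by apply: sub_finite_set surj _; apply/finite_image/finite_hecke_pairs.
Qed.

Lemma norm_3mod4_monomial_supp k :
  nonzero_ideals_norm_3mod4 L `&` [set a | ideal_norm a = k] =
  if (4 %| k.+1)%N then ideals_norm_pred4 (k.+1 %/ 4)%N else set0.
Proof.
case: ifP => [/divnK kE|k4]; apply/seteqP; split=> a //=.
- by case=> -[ida an0 _] ak; split=> //; rewrite ak mulnC kE.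
- by case=> ida an0; rewrite mulnC kE => -[ak]; split=> //; split=> //; rewrite ak; lia.
- by case=> -[_ _ a4] ak; move: a4 k4; rewrite ak; lia.
Qed.

Lemma summable_norm_3mod4 :
  fps_summable (nonzero_ideals_norm_3mod4 L) (fun a => fps_monomial (ideal_norm a)).
Proof.
move=> k; apply: (sub_finite_set
  (B := nonzero_ideals_norm_3mod4 L `&` [set a | ideal_norm a = k])).
  move=> a /= [Aa]; rewrite /fps_monomial; case: eqP => [->|]//.
rewrite norm_3mod4_monomial_supp; case: ifP => _ //.
exact: finite_ideals_norm_pred4.
Qed.

Lemma sum_norm_3mod4_coef k :
  fps_sum (nonzero_ideals_norm_3mod4 L) (fun a => fps_monomial (ideal_norm a)) k =
  if (4 %| k.+1)%N then - f6 (k.+1 %/ 4)%N else 0.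
Proof.
rewrite /fps_sum /fps_monomial.
transitivity (\sum_(a \in nonzero_ideals_norm_3mod4 L `&`
                  [set a | ideal_norm a = k]) (1 : int)).
  rewrite fsbig_mkcondr; apply: eq_fsbigr => a _.
  case: eqP => ak; first by rewrite mem_set.
  by rewrite memNset // => /= /esym.
rewrite norm_3mod4_monomial_supp; case: ifP => _; last by rewrite fsbig_set0.
rewrite f6_coef_hecke opprK.
by rewrite (reindex_fsbig _ _ _ _ (hecke_pairs_ideals_bij _)).
Qed.

End QuadraticField.

Theorem theorem1p6 (L : fieldExtType rat) (s : L) (Ls : is_Q_sqrt3 s) :
  [/\ fps_summable [set n | (1 <= n)%N] f6_term,
      fps_summable (nonzero_ideals_norm_3mod4 L)
        (fun a => fps_monomial (ideal_norm a)) &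
      laurent_shift (-1) (laurent_of_fps (fps_subst_Xn 4 f6)) =
      laurent_of_fps
        (fps_opp (fps_sum (nonzero_ideals_norm_3mod4 L)
                    (fun a => fps_monomial (ideal_norm a))))].
Proof.
split; [exact: f6_summable | exact: (summable_norm_3mod4 Ls) | ].
apply/funext => k; rewrite /laurent_shift /laurent_of_fps /fps_opp.
case: k => [k|[|k]].
- rewrite (_ : Posz k - -1 = Posz k.+1); last by lia.
  rewrite (sum_norm_3mod4_coef Ls) /fps_subst_Xn.
  by case: ifP => _; rewrite ?opprK ?oppr0.
(* The coefficient of q^(-1) is the constant term of f_6. *)
- rewrite (_ : Negz 0 - -1 = Posz 0); last by lia.
  rewrite /fps_subst_Xn dvdn0 div0n f6_coef_hecke fsbig1 ?oppr0 //.
  by move=> p /hecke_pairs_bound[].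
- by rewrite (_ : Negz k.+1 - -1 = Negz k); last by lia.
Qed.
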